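(* For any graph $F$ with minimum degree $1$, $\text{w-sat}(n,F)$ is non-increasing with respect to $n$ for $n\ge v(F)$.
   Context: All graphs are simple, finite and undirected; $v(G)$ denotes the number of vertices of $G$. Given a graph $F$, a graph $G$ is weakly $F$-saturated if the non-edges of $G$ can be added one by one in some order, ending with the complete graph on $V(G)$, so that each newly added edge creates a new copy of $F$ (a subgraph isomorphic to $F$, not necessarily induced, containing the new edge). For an integer $n$, $\text{w-sat}(n,F)$ is the minimum number of edges of an $n$-vertex weakly $F$-saturated graph. *)

(* Defs.v *)
From HB Require Import structures.
From mathcomp Require Import all_boot.
Set Implicit Arguments.
Unset Strict Implicit.
Unset Printing Implicit Defensive.

Definition pairs (T : finType) : {set {set T}} := [set e : {set T} | #|e| == 2].

Record sgraph (T : finType) := SGraph {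
  edges : {set {set T}};
  edgesP : edges \subset pairs T
}.

HB.instance Definition _ (T : finType) := [isSub for @edges T].
HB.instance Definition _ (T : finType) := [Finite of sgraph T by <:].

Definition degree (T : finType) (G : sgraph T) (x : T) : nat :=
  #|[set y | [set x; y] \in edges G]|.

(* Every degree is at most #|T|, so the default value #|T| does not affect the
   minimum; on the graph with no vertices min_degree is 0. *)
Definition min_degree (T : finType) (G : sgraph T) : nat :=
  \big[minn/#|T|]_(x : T) degree G x.

Definition nonedges (T : finType) (G : sgraph T) : {set {set T}} :=
  pairs T :\: edges G.

(* The graph with edge set E contains a (not necessarily induced) copy of F
   that uses the edge e; a copy is the image of an injection f of the vertices
   of F that sends edges to edges. *)
Definition copy_through (T U : finType) (F : sgraph T)
    (E : {set {set U}}) (e : {set U}) : bool :=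
  [exists f : {ffun T -> U},
    [&& injectiveb f,
        [forall a in edges F, f @: a \in E]
      & [exists a in edges F, f @: a == e]]].

(* The pairs in s can be added to E in this order, each of them creating a copy
   of F through itself. *)
Fixpoint saturating (T U : finType) (F : sgraph T)
    (E : {set {set U}}) (s : seq {set U}) : bool :=
  if s is e :: s' then
    copy_through F (e |: E) e && saturating F (e |: E) s'
  else true.

Definition weakly_saturated (T U : finType) (F : sgraph T) (G : sgraph U)
    : bool :=
  has (saturating F (edges G)) (permutations (enum (nonedges G))).

Definition complete_graph (T : finType) : sgraph T := SGraph (subxx (pairs T)).

Lemma weakly_saturated_complete (T U : finType) (F : sgraph T) :
  weakly_saturated F (complete_graph U).
Proof.
apply/hasP; exists [::] => //.
by rewrite mem_permutations /nonedges setDv enum_set0.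
Qed.

Lemma weakly_saturated_size_ex (T : finType) (F : sgraph T) (n : nat) :
  exists m : nat,
    [exists G : sgraph 'I_n, weakly_saturated F G && (#|edges G| == m)].
Proof.
exists #|edges (complete_graph 'I_n)|; apply/existsP.
by exists (complete_graph 'I_n); rewrite weakly_saturated_complete eqxx.
Qed.

Definition wsat (n : nat) (T : finType) (F : sgraph T) : nat :=
  ex_minn (weakly_saturated_size_ex F n).

(* Main.v *)
Require Import Defs.
From mathcomp Require Import all_boot.
From mathcomp Require Import fingroup perm.

(** It is enough to add a single vertex [w] to the vertex set, since the general
    case follows by iterating. Let [G] be weakly [F]-saturated on [U], where [U]
    has at least as many vertices as [F], and view [G] as a graph on [U] together
    with an isolated vertex [w]; this does not change the number of edges. The
    process that completes [G] on [U] still works in the larger vertex set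
    ([saturating_imset]), so that [U] becomes a clique. Minimum degree one gives
    a leaf [x] of [F] ([min_degree1_leaf]), with neighbour [y], say. Each edge
    [wu] with [u] in [U] then creates a copy of [F]: send [x] to [w], [y] to [u],
    and the rest of [F] injectively into the clique ([copy_through_pendant]).
    No edge of this copy other than [wu] meets [w], so the edges at [w] can be
    added in any order, and the complete graph is reached. *)

Set Implicit Arguments.
Unset Strict Implicit.
Unset Printing Implicit Defensive.

Lemma min_degree_le (T : finType) (F : sgraph T) (x : T) :
  min_degree F <= degree F x.
Proof.
rewrite /min_degree; elim: (index_enum T) (mem_index_enum x) => // y s IHs.
rewrite big_cons inE => /predU1P[<-|/IHs]; first exact: geq_minl.
exact: leq_trans (geq_minr _ _).
Qed.

Lemma min_degree1_leaf (T : finType) (F : sgraph T) :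
  min_degree F = 1 -> exists x, degree F x = 1.
Proof.
move=> hF; have [x /eqP|noleaf] := pickP (fun x : T => degree F x == 1).
  by exists x.
suff : min_degree F != 1 by rewrite hF.
rewrite /min_degree; elim/big_ind: _ => [|a b a_ne1 b_ne1|x _].
(* The default value is 1 only for a one-vertex graph, whose minimum degree is
   in fact 0 because it has no edges. *)
- apply/eqP => T1; have /card_gt0P[x _] : 0 < #|T| by rewrite T1.
  have : 0 < degree F x by rewrite -hF min_degree_le.
  case/card_gt0P=> y; rewrite inE => /(subsetP (edgesP F)).
  rewrite inE cards2; have /eqP -> : x == y; last by rewrite eqxx.
  by apply/eqP/(card_le1_eqP (A := predT)); rewrite ?T1.
- by rewrite /minn; case: ifP.
- by rewrite noleaf.
Qed.

Lemma copy_through_imset (T U V : finType) (F : sgraph T) (h : U -> V)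
    (E : {set {set U}}) (e : {set U}) :
  injective h -> copy_through F E e ->
  copy_through F [set h @: a | a : {set U} in E] (h @: e).
Proof.
move=> h_inj /existsP[f /and3P[/injectiveP f_inj /forall_inP fE]].
case/exists_inP=> a aF /eqP fa.
have hf (b : {set T}) : [ffun t => h (f t)] @: b = h @: (f @: b).
  by rewrite -imset_comp; apply: eq_imset => t; rewrite ffunE.
apply/existsP; exists [ffun t => h (f t)]; apply/and3P; split.
- by apply/injectiveP=> s t; rewrite !ffunE => /h_inj/f_inj.
- by apply/forall_inP=> b /fE fbE; rewrite hf imset_f.
- by apply/exists_inP; exists a; rewrite // hf fa.
Qed.

Lemma saturating_imset (T U V : finType) (F : sgraph T) (h : U -> V)
    (E : {set {set U}}) (s : seq {set U}) :
  injective h -> saturating F E s ->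
  saturating F [set h @: a | a : {set U} in E] [seq h @: a | a : {set U} <- s].
Proof.
move=> h_inj; elim: s E => //= e s IHs E /andP[eF sF].
by rewrite -imsetU1 copy_through_imset //= IHs.
Qed.

Lemma saturating_cat (T U : finType) (F : sgraph T) (E : {set {set U}})
    (s1 s2 : seq {set U}) :
  saturating F E (s1 ++ s2) =
    saturating F E s1 && saturating F (E :|: [set:: s1]) s2.
Proof.
elim: s1 E => [|e s1 IHs] E /=; first by rewrite set_nil setU0.
by rewrite IHs andbA set_cons setUA [_ |: E]setUC.
Qed.

Lemma weakly_saturatedP (T U : finType) (F : sgraph T) (G : sgraph U) :
  reflect (exists s, [/\ uniq s, s =i nonedges G & saturating F (edges G) s])
          (weakly_saturated F G).
Proof.
apply: (iffP hasP) => [[s]|[s [s_uniq sG sF]]].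
  rewrite mem_permutations => sG sF; exists s; split=> //.
    by rewrite (perm_uniq sG) enum_uniq.
  by move=> e; rewrite (perm_mem sG) mem_enum.
exists s; rewrite // mem_permutations uniq_perm ?enum_uniq // => e.
by rewrite sG mem_enum.
Qed.

(** Composing with a transposition moves the image of [y] to [u]. *)
Lemma injection_through (T U : finType) (y : T) (u : U) :
  #|T| <= #|U| -> exists2 g : T -> U, injective g & g y = u.
Proof.
move=> leTU; pose g t := enum_val (widen_ord leTU (enum_rank t)).
exists (fun t => tperm (g y) u (g t)); last by rewrite tpermL.
move=> s t /perm_inj/enum_val_inj/(congr1 val) /= eq_st.
by apply/enum_rank_inj/val_inj.
Qed.

(** The leaf of [F] goes to the new vertex [w] and its neighbour to [h u]; all
    other edges of [F] avoid the leaf, hence land in the clique on [h @: U]. *)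
Lemma copy_through_pendant (T U V : finType) (F : sgraph T) (h : U -> V)
    (E : {set {set V}}) (x : T) (w : V) (u : U) :
  degree F x = 1 -> #|T| <= #|U| -> injective h -> (forall v, h v != w) ->
  (forall a, a \in pairs U -> h @: a \in E) ->
  copy_through F ([set w; h u] |: E) [set w; h u].
Proof.
move=> /eqP/cards1P[y Nx] leTU h_inj hw clique.
have xyF z : ([set x; z] \in edges F) = (z == y).
  by have /setP/(_ z) := Nx; rewrite !inE.
have [g g_inj gy] := injection_through y u leTU.
have neq_yx : y != x.
  apply/eqP=> yx; have := xyF y; rewrite eqxx => /(subsetP (edgesP F)).
  by rewrite inE cards2 yx eqxx.
pose f := [ffun t => if t == x then w else h (g t)].
have fxy : f @: [set x; y] = [set w; h u].
  by rewrite imsetU1 imset_set1 !ffunE eqxx (negPf neq_yx) gy.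
apply/existsP; exists f; apply/and3P; split.
- apply/injectiveP=> s t; rewrite !ffunE.
  case: (s =P x) => [->|_]; case: (t =P x) => [->|_] //.
  + by move=> /esym/eqP; rewrite (negPf (hw _)).
  + by move=> /eqP; rewrite (negPf (hw _)).
  + by move=> /h_inj/g_inj.
- apply/forall_inP=> a aF; have := subsetP (edgesP F) a aF.
  rewrite inE => a2; have [xa|xNa] := boolP (x \in a).
    have /cards1P[z az] : #|a :\ x| == 1.
      by move: a2; rewrite (cardsD1 x) xa.
    have a_xz : a = [set x; z] by rewrite -(setD1K xa) az.
    move: aF; rewrite a_xz xyF => /eqP->.
    by rewrite fxy setU11.
  have -> : f @: a = h @: (g @: a).
    rewrite -imset_comp; apply: eq_in_imset => t ta.
    by rewrite ffunE; case: eqP => // tx; rewrite -tx ta in xNa.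
  by rewrite setU1r // clique // inE card_imset.
- by apply/exists_inP; exists [set x; y]; rewrite ?xyF ?fxy.
Qed.

Lemma saturating_pendants (T U V : finType) (F : sgraph T) (h : U -> V)
    (E : {set {set V}}) (x : T) (w : V) (us : seq U) :
  degree F x = 1 -> #|T| <= #|U| -> injective h -> (forall v, h v != w) ->
  (forall a, a \in pairs U -> h @: a \in E) ->
  saturating F E [seq [set w; h u] | u <- us].
Proof.
move=> Fx leTU h_inj hw; elim: us E => //= u us IHus E clique.
rewrite (copy_through_pendant u Fx) //=; apply: IHus => a aU.
by rewrite setU1r ?clique.
Qed.

Lemma imset_pairs (U V : finType) (h : U -> V) (a : {set U}) :
  injective h -> (h @: a \in pairs V) = (a \in pairs U).
Proof. by move=> h_inj; rewrite !inE card_imset. Qed.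

Lemma imset_edgesP (U V : finType) (h : U -> V) (G : sgraph U) :
  injective h -> [set h @: a | a : {set U} in edges G] \subset pairs V.
Proof.
move=> h_inj; apply/subsetP=> _ /imsetP[a aG ->].
by rewrite imset_pairs // (subsetP (edgesP G)).
Qed.

Definition imset_graph (U V : finType) (h : U -> V) (h_inj : injective h)
  (G : sgraph U) : sgraph V := SGraph (imset_edgesP G h_inj).

(** A pair of vertices of [V] either lies in the image of [h] or is an edge at
    [w]; accordingly the process first completes [G] and then joins [w] to
    every other vertex. *)
Lemma weakly_saturated_isolated (T U V : finType) (F : sgraph T) (h : U -> V)
    (h_inj : injective h) (G : sgraph U) (x : T) (w : V) :
  degree F x = 1 -> #|T| <= #|U| -> (forall u, h u != w) ->
  (forall v, v != w -> exists u, v = h u) ->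
  weakly_saturated F G -> weakly_saturated F (imset_graph h_inj G).
Proof.
move=> Fx leTU hw hV /weakly_saturatedP[s [s_uniq sG sF]].
have himset_inj : injective (fun a : {set U} => h @: a) by apply: imset_inj.
have wNh (a : {set U}) : w \notin h @: a.
  by apply/imsetP=> -[u _ wu]; have := hw u; rewrite wu eqxx.
have pendantNh (a : {set U}) u : ([set w; h u] == h @: a) = false.
  by apply/eqP=> ea; have := wNh a; rewrite -ea set21.
apply/weakly_saturatedP.
exists ([seq h @: a | a : {set U} <- s] ++ [seq [set w; h u] | u <- enum U]).
split.
- rewrite cat_uniq (map_inj_uniq himset_inj) s_uniq map_inj_uniq ?enum_uniq.
    rewrite andbT; apply/hasPn=> _ /mapP[u _ ->].
    by apply/mapP=> -[a _ /eqP]; rewrite pendantNh.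
  move=> u v /setP/(_ (h u)); rewrite !inE eqxx (negPf (hw _)) /=.
  by move/esym/eqP/h_inj.
- move=> e; rewrite mem_cat [RHS]inE /=; apply/idP/idP.
    case/orP=> /mapP[].
      move=> a; rewrite sG inE => /andP[aNG aU] ->.
      by rewrite mem_imset // aNG imset_pairs.
    move=> u _ ->; rewrite inE cards2 [w == _]eq_sym hw andbT.
    by apply/imsetP=> -[a _ /eqP]; rewrite pendantNh.
  case/andP=> eNG eV; have [we|wNe] := boolP (w \in e).
    apply/orP; right.
    have /cards1P[v ev] : #|e :\ w| == 1.
      by move: eV; rewrite inE (cardsD1 w) we.
    have : v \in e :\ w by rewrite ev set11.
    rewrite 2!inE => /andP[/hV[u vu] _]; apply/mapP; exists u.
      by rewrite mem_enum.
    by rewrite -vu -ev setD1K.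
  apply/orP; left.
  have e_h : e = h @: (h @^-1: e).
    apply/setP=> v; apply/idP/imsetP=> [ve|[u]]; last by rewrite inE => ? ->.
    have /hV[u vu] : v != w by apply: contraNneq wNe => <-.
    by exists u; rewrite // inE -vu.
  apply/mapP; exists (h @^-1: e) => //; rewrite sG inE.
  by move: eNG eV; rewrite e_h mem_imset // imset_pairs // -e_h => -> ->.
- rewrite saturating_cat saturating_imset //=.
  apply: (saturating_pendants _ Fx) => // a aU; rewrite 2!inE mem_imset //.
  by rewrite mem_map // sG inE aU andbT orbN.
Qed.

Lemma wsat_le_edges (T : finType) (F : sgraph T) (n : nat) (G : sgraph 'I_n) :
  weakly_saturated F G -> wsat n F <= #|edges G|.
Proof.
move=> GF; rewrite /wsat; case: ex_minnP => k _; apply.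
by apply/existsP; exists G; rewrite GF eqxx.
Qed.

Lemma wsat_witness (T : finType) (F : sgraph T) (n : nat) :
  exists2 G : sgraph 'I_n, weakly_saturated F G & #|edges G| = wsat n F.
Proof.
rewrite /wsat; case: ex_minnP => k /existsP[G /andP[GF /eqP Gk]] _.
by exists G.
Qed.

Lemma wsatS (T : finType) (F : sgraph T) (x : T) (n : nat) :
  degree F x = 1 -> #|T| <= n -> wsat n.+1 F <= wsat n F.
Proof.
move=> Fx leTn; have [G GF <-] := wsat_witness F n.
have h_inj : injective (lift (@ord_max n)) := @lift_inj _ _.
rewrite -[leqRHS](card_imset _ (imset_inj h_inj)).
apply: (wsat_le_edges (G := imset_graph h_inj G)).
apply: (weakly_saturated_isolated (w := ord_max) _ Fx) => //.
- by rewrite card_ord.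
- by move=> u; rewrite eq_sym neq_lift.
- by move=> v; case: (unliftP ord_max v) => [u ->|->]; [exists u | rewrite eqxx].
Qed.

Theorem proposition1p1 (T : finType) (F : sgraph T) (hF : min_degree F = 1)
    (m n : nat) (hm : #|T| <= m) (hmn : m <= n) :
  wsat n F <= wsat m F.
Proof.
have [x Fx] := min_degree1_leaf hF.
rewrite -(subnKC hmn); elim: (n - m) => [|k IHk]; first by rewrite addn0.
rewrite addnS; apply: leq_trans IHk; apply: wsatS Fx _.
exact: leq_trans (leq_addr _ _).
Qed.
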